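(* Let $0<p<1$ and $p_c<p$ be fixed. Let $x\to\infty$ and $t\to\infty$ through positive integers such that $x\le t$ and $1-x/t=p_c$. Let $h_t(x)$ be the height function of oriented digital boiling with parameter $p$ and corner initialization. Then $$\mathrm{Prob}\left(h_t(x)=p_c\,t\right)\longrightarrow 1 .$$
   Context: Oriented digital boiling (ODB) with parameter $p$ and corner initialization: a random height function $h_t:\mathbb{Z}_+\to\mathbb{Z}_+\cup\{-\infty\}$, $t=0,1,2,\dots$ (where $\mathbb{Z}_+=\{0,1,2,\dots\}$), with $h_0(0)=0$, $h_0(x)=-\infty$ for $x\ge1$, the convention $h_t(-1)=-\infty$ (and $-\infty+1=-\infty$), evolving as follows. If $h_t(x-1)>h_t(x)$ then $h_{t+1}(x)=h_t(x-1)$. Otherwise, independently of all other sites and times, $h_{t+1}(x)=h_t(x)+1$ with probability $p$ and $h_{t+1}(x)=h_t(x)$ with probability $1-p$. Equivalently $h_{t}(x)=\max\{h_{t-1}(x-1),\,h_{t-1}(x)+\epsilon_{x,t}\}$ with $\epsilon_{x,t}$ i.i.d. Bernoulli($p$). Note that $p_c t=t-x$ is an integer. *)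

(* Defs.v *)
From HB Require Import structures.
From mathcomp Require Import all_boot all_order all_algebra finmap.
From mathcomp Require Import all_classical all_reals all_analysis.

Set Implicit Arguments.
Unset Strict Implicit.
Unset Printing Implicit Defensive.

Import Order.TTheory GRing.Theory Num.Theory.
Import numFieldNormedType.Exports.

Local Open Scope classical_set_scope.
Local Open Scope ring_scope.

Definition mutually_independent (d d' : measure_display)
    (T : measurableType d) (E : measurableType d') (R : realType)
    (P : probability T R) (I : choiceType) (X : I -> {RV P >-> E}) : Prop :=
  forall (J : {fset I}) (B : I -> set E),
    (forall i, i \in J -> measurable (B i)) ->
    P (\bigcap_(i in [set` J]) (X i @^-1` B i)) =
      (\prod_(i <- J) P (X i @^-1` B i))%E.

Definition iid_bernoulli (d : measure_display) (T : measurableType d)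
    (R : realType) (P : probability T R) (p : R) (I : choiceType)
    (X : I -> {RV P >-> bool}) : Prop :=
  (forall i, distribution P (X i) =1 bernoulli_prob p) /\
  mutually_independent X.

(* An element of {0, 1, 2, ...} together with -oo, the latter being [None]. *)
Definition height := option nat.

Definition height_lt (a b : height) : bool :=
  match a, b with
  | _, None => false
  | None, Some _ => true
  | Some m, Some n => (m < n)%N
  end.

Definition height_to_ereal (R : realType) (a : height) : \bar R :=
  if a is Some n then (n%:R)%:E else -oo%E.

(* The value at x - 1, with the convention that it is -oo for x = 0. *)
Definition left_height (h : nat -> height) (x : nat) : height :=
  if x is y.+1 then h y else None.

(* [odb c t x] is the height h_t(x) started from the corner; the coin [c (s, y)]
   is the one used at site y in the step from time s to time s + 1, i.e. it is
   epsilon_{y, s+1}. *)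
Fixpoint odb (c : nat * nat -> bool) (t : nat) : nat -> height :=
  if t is s.+1 then
    fun x =>
      let h := odb c s in
      if height_lt (h x) (left_height h x) then left_height h x
      else if c (s, x) then omap S (h x) else h x
  else fun x => if x is 0 then Some 0%N else None.

(* Main.v *)
(** A site is reached with the maximal possible height [t - x] iff it is reached
    by a lattice path all of whose waiting steps use successful coins; moves to
    the right are free. Indexing sites by [n = t - x], a reached [n] stays
    reached, and [n + 1] is added when [n] is reached and its coin succeeds, so
    the reached values form an initial segment [0, M_t] with
    [M_(t+1) = M_t + c (t, t - M_t)]. The coins read by [M] sit at distinct
    space-time points, hence [M_t] is binomial with parameters [t] and [p], and
    Chernoff's bound gives [M_t >= pc t] with probability tending to 1. *)

Require Import Defs.
From HB Require Import structures.
From mathcomp Require Import all_boot all_order all_algebra finmap.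
From mathcomp Require Import all_classical all_reals all_analysis.
From mathcomp Require Import zify ring lra.

Set Implicit Arguments.
Unset Strict Implicit.
Unset Printing Implicit Defensive.

Import Order.TTheory GRing.Theory Num.Theory.
Import numFieldNormedType.Exports.

Local Open Scope classical_set_scope.
Local Open Scope ring_scope.

(** * Sites of maximal height *)

(* [front c t] is the largest [n] such that [h_t(t - n) = n]. *)
Fixpoint front (c : nat * nat -> bool) (t : nat) : nat :=
  if t is s.+1 then (front c s + c (s, s - front c s))%N else 0%N.

Lemma front_le c t : (front c t <= t)%N.
Proof. by elim: t => //= t IH; case: (c _); lia. Qed.

Lemma odb_add_le c t y n : odb c t y = Some n -> (n + y <= t)%N.
Proof.
elim: t y n => [[|y] n //= [<-] //|t IH y n] /=.
case: ifP => _.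
  by case: y => [|y] //= /IH; lia.
case: (odb c t y) (IH y) => [m|] IHy; last by case: (c _).
by have := IHy _ erefl; case: (c _) => /= + [<-]; lia.
Qed.

(** By [odb_add_le], the old heights at [y] and at its left neighbour are at most [k] and [k.+1].
    This leaves only two sources for [k.+1], and a left neighbour that overrides a successful coin
    at height [k] must itself be at [k.+1]. *)
Lemma odb_fullS c t y k : (k.+1 + y = t.+1)%N ->
  (odb c t.+1 y == Some k.+1) =
  (if y is z.+1 then odb c t z == Some k.+1 else false) ||
  c (t, y) && (odb c t y == Some k).
Proof.
case: y => [|z] kyt /=; set e := c _.
  have := @odb_add_le c t 0; case: (odb c t 0) => [m|] /= => [/(_ _ erefl) mt|_];
    case: e => //=; rewrite !(inj_eq Some_inj); lia.
have := @odb_add_le c t z; have := @odb_add_le c t z.+1.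
case: (odb c t z.+1) => [b|] /= => [/(_ _ erefl) bt|_];
  case: (odb c t z) => [a|] /= => [/(_ _ erefl) a_t|_];
  case: e => //=; rewrite ?(inj_eq Some_inj) ?orbF //; try lia;
  case: ifP => ab; rewrite ?(inj_eq Some_inj); lia.
Qed.

Lemma odb_diag c t : odb c t t = Some 0%N.
Proof.
elim: t => //= t IH; rewrite IH.
by case E : (odb c t t.+1) => [b|] //; have := odb_add_le E; lia.
Qed.

Lemma odb_full c t y n : (n + y = t)%N ->
  (odb c t y == Some n) = (n <= front c t)%N.
Proof.
elim: t y n => [|t IH] y [|k] ny;
  try by move: ny; rewrite add0n => ->; rewrite odb_diag.
  by [].
rewrite odb_fullS // IH; last lia.
have fle := front_le c t.
have -> : (if y is z.+1 then odb c t z == Some k.+1 else false) =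
          (k < front c t)%N.
  by case: y ny => [|z] ny; [apply/esym/negbTE; lia | rewrite IH //; lia].
(* Below the front a free right move suffices, above it there is no source; the coin decides only
   when [k] is the front, and then it sits at site [t - k]. *)
rewrite /=; have [kf|fk|kE] := ltngtP k (front c t).
- by case: (c _) (c _) => -[]; lia.
- by case: (c _) (c _) => -[]; lia.
- have -> : y = (t - k)%N by lia.
  by rewrite -kE; case: (c _); rewrite ?addn1 ?addn0 ?ltnSn ?ltnn.
Qed.

(** Prescribing the increments [b] makes the positions of the coins read by the front deterministic,
    so that independence can be applied to them. *)
Lemma front_eq c (b : nat -> bool) t :
  (forall s, (s < t)%N -> c (s, (s - \sum_(r < s) b r)%N) = b s) ->
  front c t = (\sum_(r < t) b r)%N.
Proof.
elim: t => [|t IH] cb; first by rewrite big_ord0.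
by rewrite big_ord_recr /= IH ?cb // => s st; apply: cb; rewrite ltnW.
Qed.

Lemma front_sum c t :
  front c t = (\sum_(s < t) c (val s, (s - front c s)%N))%N.
Proof. by elim: t => [|t IH]; rewrite ?big_ord0 // big_ord_recr /= -IH. Qed.

(** * Law of the front *)

Definition coin_weight (R : realType) (p : R) (e : bool) : R :=
  if e then p else 1 - p.

Lemma iid_bernoulliE (d : measure_display) (T : measurableType d)
    (R : realType) (P : probability T R) (p : R) (I : choiceType)
    (X : I -> {RV P >-> bool}) i e :
  0 <= p <= 1 -> iid_bernoulli p X ->
  P (X i @^-1` [set e]) = (coin_weight p e)%:E.
Proof.
move=> p01 [Xp _].
rewrite -[LHS]/(distribution P (X i) [set e]) Xp bernoulli_probE //.
by case: e; rewrite !diracE ?in_set1 ?inE /= ?mem_set //= ?memNset //= 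
  ?mule1 ?mule0 ?adde0 ?add0e.
Qed.

(* The increments of the front follow [b] up to time [t]. *)
Definition path_event (T : Type) (c : nat * nat -> T -> bool)
    (b : nat -> bool) (t : nat) : set T :=
  [set w | forall s, (s < t)%N -> c (s, (s - \sum_(r < s) b r)%N) w = b s].

Lemma path_event_bigcap (T : Type) (c : nat * nat -> T -> bool) b t :
  path_event c b t =
  \bigcap_(i in [set` [fset (s, (s - \sum_(r < s) b r)%N) | s in iota 0 t]%fset])
    (c i @^-1` [set b i.1]).
Proof.
apply/seteqP; split => w /= cb.
  by move=> _ /imfsetP[s /= + ->]; rewrite mem_iota => /cb.
move=> s st; apply: (cb (s, _)); apply/imfsetP; exists s => //=.
by rewrite mem_iota.
Qed.

(** A sum over paths calls for a finite type, while [path_event] takes a sequence on [nat]; indices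
    from [t] on get [false]. *)
Definition ffun_ext t (f : {ffun 'I_t -> bool}) (s : nat) : bool :=
  oapp f false (insub s).

Lemma ffun_extE t (f : {ffun 'I_t -> bool}) (i : 'I_t) : ffun_ext f i = f i.
Proof. by rewrite /ffun_ext valK. Qed.

Lemma measure_bigsetU_le (d : measure_display) (T : measurableType d)
    (R : realType) (mu : {measure set T -> \bar R}) (I : Type) (r : seq I)
    (Q : pred I) (A : I -> set T) :
  (forall i, Q i -> measurable (A i)) ->
  (mu (\big[setU/set0]_(i <- r | Q i) A i) <= \sum_(i <- r | Q i) mu (A i))%E.
Proof.
move=> mA; elim: r => [|i r IH]; first by rewrite !big_nil measure0.
rewrite !big_cons; case: ifP => // Qi.
apply: (@le_trans _ _ (mu (A i) + mu (\big[setU/set0]_(j <- r | Q j) A j))%E).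
  apply: measureU2; first exact: mA.
  exact: bigsetU_measurable.
exact: leeD2l.
Qed.

Section FrontLaw.
Context (R : realType) (d : measure_display) (T : measurableType d).
Context (P : probability T R) (p : R) (p01 : 0 <= p <= 1).
Context (c : nat * nat -> {RV P >-> bool}) (hc : iid_bernoulli p c).

Let measurable_coin i (B : set bool) : measurable (c i @^-1` B).
Proof. by rewrite -[X in measurable X]setTI; exact: measurable_funP. Qed.

Lemma measurable_path_event b t : measurable (path_event c b t).
Proof.
rewrite path_event_bigcap bigcap_fset.
by apply: bigsetI_measurable => i _.
Qed.

Lemma path_event_prob b t :
  P (path_event c b t) = (\prod_(s < t) coin_weight p (b s))%:E.
Proof.
rewrite path_event_bigcap hc.2 //.
(* The time coordinate alone tells the coins apart, so the indexing is injective. *)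
rewrite eq_big_imfset /=; last by move=> s r _ _ [].
rewrite undup_id ?iota_uniq // big_map -prodEFin -[t in iota 0 t]subn0.
rewrite -(big_mkord xpredT (fun s => (coin_weight p (b s))%:E)).
by apply: eq_bigr => s _; exact: iid_bernoulliE.
Qed.

Lemma front_lt_bigcup k t :
  [set w | (front (fun i => c i w) t < k)%N] =
  \big[setU/set0]_(f : {ffun 'I_t -> bool} | (\sum_r f r < k)%N)
    path_event c (ffun_ext f) t.
Proof.
apply/seteqP; split => w /=.
  rewrite front_sum => fk.
  (* The witness records the outcomes of the coins that the front actually reads. *)
  pose f := [ffun i : 'I_t => c (val i, (i - front (fun j => c j w) i)%N) w].
  have fE i : f i = c (val i, (i - front (fun j => c j w) i)%N) w.
    by rewrite ffunE.
  rewrite -bigcup_seq_cond; exists f => /=.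
    by rewrite mem_index_enum /=; under eq_bigr do rewrite fE.
  move=> s st; rewrite (ffun_extE f (Ordinal st)) fE /=.
  congr (c (_, (_ - _)%N) w); rewrite front_sum.
  apply: eq_bigr => r _; by rewrite (ffun_extE f (widen_ord (ltnW st) r)) fE.
rewrite -bigcup_seq_cond => -[f /= /andP[_ fk] wf].
by rewrite (front_eq wf); under eq_bigr do rewrite ffun_extE.
Qed.

Lemma measurable_front_lt k t :
  measurable [set w | (front (fun i => c i w) t < k)%N].
Proof.
rewrite front_lt_bigcup; apply: bigsetU_measurable => f _.
exact: measurable_path_event.
Qed.

(* Markov's inequality for [a ^+ front], whose mean factorizes over the steps. *)
Lemma front_lt_prob k t (a : R) : 0 < a <= 1 ->
  (P [set w | (front (fun i => c i w) t < k)%N] <=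
   ((p * a + (1 - p)) ^+ t / a ^+ k)%:E)%E.
Proof.
move=> /andP[a0 a1]; have [p0 p1] := andP p01.
have w0 e : 0 <= coin_weight p e by case: e; rewrite /= ?subr_ge0.
rewrite front_lt_bigcup.
apply: le_trans; first apply: measure_bigsetU_le.
  by move=> f _; exact: measurable_path_event.
rewrite (eq_bigr _ (fun f _ => path_event_prob (ffun_ext f) t)).
rewrite sumEFin lee_fin ler_pdivlMr ?exprn_gt0 // mulr_suml.
(* Expanding a product of [t] equal two-term sums yields one term per path. *)
have -> : (p * a + (1 - p)) ^+ t =
    \sum_(f : {ffun 'I_t -> bool}) \prod_i (coin_weight p (f i) * a ^+ f i).
  rewrite -(bigA_distr_bigA (fun (_ : 'I_t) (e : bool) =>
    coin_weight p e * a ^+ e)) prodr_const card_ord.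
  by rewrite big_bool /= expr1 expr0 mulr1.
(* Termwise: [a <= 1] gives [a ^+ k <= a ^+ (\sum_r f r)] on paths with sum below [k]; the remaining
   terms are nonnegative. *)
rewrite big_mkcond; apply: ler_sum => f _.
rewrite big_split /= prodrXr.
have W0 : 0 <= \prod_(i < t) coin_weight p (f i) by apply: prodr_ge0.
rewrite (eq_bigr (fun i => coin_weight p (f i))); last first.
  by move=> i _; rewrite ffun_extE.
case: ifP => fk; last by rewrite mulr_ge0 // exprn_ge0 // ltW.
by rewrite ler_wpM2l // ler_wiXn2l ?(ltW a0) ?(ltnW fk).
Qed.

End FrontLaw.

(** * Exponential decay and the limit *)

Lemma chernoff_rate (R : realType) (p q : R) : 0 < p < 1 -> q < p ->
  exists a r : R, [/\ 0 < a <= 1, 0 <= r < 1 &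
    forall t k : nat, k%:R = q * t%:R ->
      (p * a + (1 - p)) ^+ t / a ^+ k <= r ^+ t].
Proof.
move=> /andP[p0 p1] qp; pose l := p - q; have l0 : 0 < l by rewrite subr_gt0.
pose a := expR (- l); pose g := p * (1 - a) - q * l.
have a0 : 0 < a by exact: expR_gt0.
have a1 : a <= 1 by rewrite -expR0 ler_expR oppr_le0 ltW.
have g0 : 0 < g.
  have la : a * (1 + l) <= 1.
    rewrite -[leRHS](expRxMexpNx_1 l) mulrC ler_wpM2r ?expR_ge0 //.
    exact: expR_ge1Dx.
  (* The choice [l = p - q] gives [g * (1 + l) = p * (1 - a * (1 + l)) + l ^+ 2 * (1 - q)]. *)
  rewrite -(pmulr_lgt0 _ (_ : 0 < 1 + l)); last by lra.
  have lq : 0 < l * (1 - q) * l by rewrite !mulr_gt0 // subr_gt0; lra.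
  have : 0 <= p * (1 - a * (1 + l)) by rewrite mulr_ge0 ?subr_ge0 // ltW.
  by rewrite /g /l in lq *; lra.
exists a, (expR (- g)); split; first by rewrite a0 a1.
  by rewrite expR_ge0 -[ltRHS]expR0 ltr_expR oppr_lt0.
move=> t k kE; rewrite ler_pdivrMr ?exprn_gt0 //.
have -> : a ^+ k = expR (- (q * l)) ^+ t.
  by rewrite -!expRM_natr kE; congr expR; ring.
rewrite -exprMn -expRD lerXn2r ?nnegrE ?expR_ge0 //.
  by rewrite addr_ge0 ?mulr_ge0 ?subr_ge0 // ltW.
(* The exponent is [- (g + q * l) = - p * (1 - a)], and the base is [1 - p * (1 - a)]. *)
apply: le_trans (expR_ge1Dx _); rewrite /g; lra.
Qed.

Theorem mainTheorem3 (R : realType) (d : measure_display)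
    (T : measurableType d) (P : probability T R)
    (p pc : R) (hp0 : 0 < p) (hp1 : p < 1) (hpc : pc < p)
    (c : nat * nat -> {RV P >-> bool}) (hc : iid_bernoulli p c)
    (x t : nat -> nat)
    (hx0 : forall n, (0 < x n)%N) (ht0 : forall n, (0 < t n)%N)
    (hxt : forall n, (x n <= t n)%N)
    (hratio : forall n, 1 - (x n)%:R / (t n)%:R = pc)
    (hx : x n @[n --> \oo] --> \oo) (ht : t n @[n --> \oo] --> \oo) :
  P [set w | height_to_ereal R (odb (fun i => c i w) (t n) (x n))
             = (pc * (t n)%:R)%:E] @[n --> \oo] --> 1%E.
Proof.
have p01 : 0 <= p <= 1 by rewrite !ltW.
have kE n : (t n - x n)%:R = pc * (t n)%:R :> R.
  rewrite natrB // -(hratio n) mulrBl mul1r divfK // pnatr_eq0; have := ht0 n; lia.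
have hp01 : 0 < p < 1 by rewrite hp0.
have [a [r [a01 /andP[r0 r1] ar]]] := chernoff_rate hp01 hpc.
(* By [kE] the target height is the maximal one at [x n], so [odb_full] applies. *)
have eventE n : [set w | height_to_ereal R (odb (fun i => c i w) (t n) (x n))
             = (pc * (t n)%:R)%:E] =
    ~` [set w | (front (fun i => c i w) (t n) < t n - x n)%N].
  apply/seteqP; split => w /=; rewrite -kE.
    move=> h; apply/negP; rewrite -leqNgt.
    rewrite -(@odb_full _ _ (x n)) ?subnK //.
    by case: (odb _ _ _) h => //= m [] /eqP; rewrite eqr_nat => /eqP ->.
  move=> /negP; rewrite -leqNgt -(@odb_full _ _ (x n)) ?subnK //.
  by move=> /eqP ->.
apply: (@squeeze_cvge _ _ _ _ (fun n => (1 - r ^+ t n)%:E) _ (cst 1%E)).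
- near=> n; rewrite eventE probability_le1 ?andbT; last first.
    by apply: measurableC; exact: measurable_front_lt.
  rewrite probability_setC; last exact: measurable_front_lt.
  rewrite EFinB leeB // (le_trans (front_lt_prob p01 hc _ _ a01)) //.
  by rewrite lee_fin ar.
- apply/cvg_EFin; first by near=> n.
  rewrite /= -[X in _ --> X]subr0; apply: cvgB; first exact: cvg_cst.
  apply: (@cvg_comp _ _ _ t (fun n => r ^+ n) _ _ _ ht).
  by apply: cvg_expr; rewrite ger0_norm.
- exact: cvg_cst.
Unshelve. all: by end_near. Qed.
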